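(* Let $\mathcal{M}_1=(S_1,T_1,\emptyset,\Phi_1)$ and $\mathcal{M}_2=(S_2,T_2,\emptyset,\Phi_2)$ be finite BMTS over an action alphabet $\Sigma$, and let $s\in S_1$, $t\in S_2$. Let $Ap = X_R\uplus X_{T1}\uplus X_{T2}$ with $X_R=S_1\times S_2$, $X_{T1}=T_1$ and $X_{T2}=S_1\times T_2$ (elements of $X_{T2}$ written $(u,v,a,v')$ with $u\in S_1$, $(v,a,v')\in T_2$). For $u\in S_1$ let $\pi_u:\mathcal B(\Sigma\times S_1)\to\mathcal B(Ap)$ be the map replacing each atom $(a,x)$ by the atom $(u,a,x)$ (and commuting with $\mathbf{tt},\neg,\wedge,\vee$), and for $u\in S_1,v\in S_2$ let $\pi_{u,v}:\mathcal B(\Sigma\times S_2)\to\mathcal B(Ap)$ replace each atom $(a,x)$ by $(u,v,a,x)$. Define $$\varphi_{u,v}=\bigwedge_{u^*=(u,a,u')\in X_{T1}}\Big(u^*\Rightarrow\bigvee_{v^*=(u,v,a,v')\in X_{T2}}\big(v^*\wedge (u',v')\big)\Big)\ \wedge\ \bigwedge_{v^*=(u,v,a,v')\in X_{T2}}\Big(v^*\Rightarrow\bigvee_{u^*=(u,a,u')\in X_{T1}}\big(u^*\wedge (u',v')\big)\Big),$$ (where in each inner disjunction the action $a$ is the same as in the outer conjunct), $\psi_{u,v}=\pi_u(\Phi_1(u))\Rightarrow\big(\pi_{u,v}(\Phi_2(v))\wedge\varphi_{u,v}\big)$, and $$\Psi_{s,t}=(s,t)\wedge\bigwedge_{(u,v)\in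 X_R}\big((u,v)\Rightarrow\psi_{u,v}\big).$$ Then $s\le_m t$ if and only if there exists a valuation of the atoms in $X_R$ such that for every valuation of the atoms in $X_{T1}$ there exists a valuation of the atoms in $X_{T2}$ such that the union of these valuations satisfies $\Psi_{s,t}$ (i.e. $\exists X_R\,\forall X_{T1}\,\exists X_{T2}\,\Psi_{s,t}$ is a true quantified Boolean formula).
   Context: Boolean formulae over a set $X$ of atoms: $\varphi::=\mathbf{tt}\mid x\mid\neg\varphi\mid\varphi\wedge\varphi\mid\varphi\vee\varphi$ ($x\in X$); $\mathcal B(X)$ is the set of them; a valuation $\nu\subseteq X$ (the set of true atoms) satisfies formulas in the standard way; $\Rightarrow$ is the usual implication. A BMTS (Boolean modal transition system) over $\Sigma$ is a tuple $(S,T,\emptyset,\Phi)$ with $S$ a set of states, $T\subseteq S\times\Sigma\times S$ a transition relation and $\Phi:S\to\mathcal B(\Sigma\times S)$ an obligation function such that whenever $(a,t)$ occurs in $\Phi(s)$ then $(s,a,t)\in T$. For a state $s$, $T(s)=\{(a,t)\mid (s,a,t)\in T\}$ and $\mathrm{Tran}(s)=\{E\subseteq T(s)\mid E\models\Phi(s)\}$. Modal refinement: $s_0\le_m t_0$ iff $(s_0,t_0)$ belongs to some relation $R\subseteq S_1\times S_2$ such that for every $(s,t)\in R$: for all $M\in\mathrm{Tran}(s)$ there is $N\in\mathrm{Tran}(t)$ such that for every $(a,s')\in M$ there is $(a,t')\in N$ with $(s',t')\in R$, and for every $(a,t')\in N$ there is $(a,s')\in M$ with $(s',t')\in R$. 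*)

(* Defs.v *)
From HB Require Import structures.
From mathcomp Require Import all_boot.
From mathcomp Require Import finmap.

Set Implicit Arguments.
Unset Strict Implicit.
Unset Printing Implicit Defensive.

Local Open Scope fset_scope.

Inductive form (X : Type) : Type :=
  | Tt
  | Atom of X
  | Not of form X
  | And of form X & form X
  | Or of form X & form X.
Arguments Tt {X}.

Fixpoint atoms (X : Type) (phi : form X) : seq X :=
  match phi with
  | Tt => [::]
  | Atom x => [:: x]
  | Not p => atoms p
  | And p q | Or p q => atoms p ++ atoms q
  end.

(* A valuation is identified with its set of true atoms. *)
Fixpoint sat (X : Type) (nu : {pred X}) (phi : form X) : bool :=
  match phi with
  | Tt => true
  | Atom x => x \in nu
  | Not p => ~~ sat nu p
  | And p q => sat nu p && sat nu q
  | Or p q => sat nu p || sat nu q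
  end.

Fixpoint map_form (X Y : Type) (f : X -> Y) (phi : form X) : form Y :=
  match phi with
  | Tt => Tt
  | Atom x => Atom (f x)
  | Not p => Not (map_form f p)
  | And p q => And (map_form f p) (map_form f q)
  | Or p q => Or (map_form f p) (map_form f q)
  end.

Definition Ff {X : Type} : form X := Not Tt.
Definition Imp (X : Type) (p q : form X) : form X := Or (Not p) q.

Definition src (A S : Type) (e : S * A * S) : S := e.1.1.
Definition act (A S : Type) (e : S * A * S) : A := e.1.2.
Definition tgt (A S : Type) (e : S * A * S) : S := e.2.

(* Finite Boolean modal transition systems: finitely many states and
   transitions, over a possibly infinite alphabet. *)
Record bmts (A : choiceType) : Type := BMTS {
  state :> finType;
  trans : {fset state * A * state};
  oblig : state -> form (A * state);
  obligP : forall (s : state) (a : A) (t : state),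
    (a, t) \in atoms (oblig s) -> (s, a, t) \in trans
}.

Section Refinement.
Variable A : choiceType.

Definition out (M : bmts A) (s : M) : {fset A * M} :=
  [fset (act e, tgt e) | e in trans M & src e == s].

Definition Tran (M : bmts A) (s : M) : {fset {fset A * M}} :=
  [fset E in fpowerset (out s) | sat (mem E) (oblig s)].

Definition is_refinement (M1 M2 : bmts A) (R : {set M1 * M2}) : Prop :=
  forall (s : M1) (t : M2), (s, t) \in R ->
  forall M, M \in Tran s ->
  exists2 N, N \in Tran t &
    (forall a s', (a, s') \in M ->
       exists2 t', (a, t') \in N & (s', t') \in R) /\
    (forall a t', (a, t') \in N ->
       exists2 s', (a, s') \in M & (s', t') \in R).

Definition refines (M1 M2 : bmts A) (s : M1) (t : M2) : Prop :=
  exists2 R : {set M1 * M2}, (s, t) \in R & is_refinement R.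

End Refinement.

Section Encoding.
Variables (A : choiceType) (M1 M2 : bmts A).

(* The type also contains atoms for triples that are not transitions; by
   [obligP] they do not occur in [Psi] below, and the valuations considered
   are contained in [XT1] and [XT2]. *)
Inductive Ap : Type :=
  | AR of M1 * M2
  | AT1 of M1 * A * M1
  | AT2 of M1 * (M2 * A * M2).

Definition XT1 : {fset M1 * A * M1} := trans M1.
Definition XT2 : {fset M1 * (M2 * A * M2)} :=
  [fset u in M1] `*` trans M2.

Definition union_val (nR : {set M1 * M2}) (n1 : {fset M1 * A * M1})
    (n2 : {fset M1 * (M2 * A * M2)}) : {pred Ap} :=
  fun x => match x with
           | AR p => p \in nR
           | AT1 e => e \in n1
           | AT2 f => f \in n2
           end.

Definition pi1 (u : M1) : form (A * M1) -> form Ap :=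
  map_form (fun x => AT1 (u, x.1, x.2)).

Definition pi2 (u : M1) (v : M2) : form (A * M2) -> form Ap :=
  map_form (fun x => AT2 (u, (v, x.1, x.2))).

Definition phi (u : M1) (v : M2) : form Ap :=
  And
    (\big[@And Ap/Tt]_(e <- XT1 | src e == u)
       Imp (Atom (AT1 e))
         (\big[@Or Ap/Ff]_(f <- XT2 |
              [&& f.1 == u, src f.2 == v & act f.2 == act e])
            And (Atom (AT2 f)) (Atom (AR (tgt e, tgt f.2)))))
    (\big[@And Ap/Tt]_(f <- XT2 | (f.1 == u) && (src f.2 == v))
       Imp (Atom (AT2 f))
         (\big[@Or Ap/Ff]_(e <- XT1 | (src e == u) && (act e == act f.2))
            And (Atom (AT1 e)) (Atom (AR (tgt e, tgt f.2))))).

Definition psi (u : M1) (v : M2) : form Ap :=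
  Imp (pi1 u (oblig u)) (And (pi2 u v (oblig v)) (phi u v)).

Definition Psi (s : M1) (t : M2) : form Ap :=
  And (Atom (AR (s, t)))
    (\big[@And Ap/Tt]_(p : M1 * M2) Imp (Atom (AR p)) (psi p.1 p.2)).

End Encoding.

(* Main.v *)
Require Import Defs.
From mathcomp Require Import all_boot.
From mathcomp Require Import finmap.

Local Open Scope fset_scope.

(** The atoms true in a valuation of [X_T1] split over the states [u] into
    arbitrary sets [M] of outgoing transitions of [u], and a valuation of [X_T2]
    splits over the pairs [(u, v)] into sets [N] of outgoing transitions of [v].
    Read on these slices, [psi_{u,v}] is the transfer condition of modal
    refinement for the relation [X_R]. As the slices for distinct pairs involve
    disjoint atoms, the answers [N] can be chosen independently for each
    [(u, v)]. *)

Section Formulas.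
Set Implicit Arguments.
Unset Strict Implicit.
Variables (X Y : Type).

Lemma sat_map (f : X -> Y) (nu : {pred Y}) p :
  sat nu (map_form f p) = sat [pred x | f x \in nu] p.
Proof. by elim: p => //= [p -> | p -> q -> | p -> q ->]. Qed.

Lemma eq_sat (nu nu' : {pred X}) p : nu =i nu' -> sat nu p = sat nu' p.
Proof. by move=> eq_nu; elim: p => //= [p -> | p -> q -> | p -> q ->]. Qed.

Lemma sat_bigAnd (I : Type) (r : seq I) (P : pred I) (F : I -> form X) nu :
  sat nu (\big[@And X/Tt]_(i <- r | P i) F i)
  = all [pred i | P i ==> sat nu (F i)] r.
Proof. by rewrite (big_morph (sat nu) (op1 := andb) (id1 := true)) ?big_all_cond. Qed.

Lemma sat_bigOr (I : Type) (r : seq I) (P : pred I) (F : I -> form X) nu :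
  sat nu (\big[@Or X/Ff]_(i <- r | P i) F i)
  = has [pred i | P i && sat nu (F i)] r.
Proof. by rewrite (big_morph (sat nu) (op1 := orb) (id1 := false)) ?big_has_cond. Qed.

End Formulas.

Section Slices.
Set Implicit Arguments.
Unset Strict Implicit.
Variables (A : choiceType) (M1 M2 : bmts A).
Implicit Types (u : M1) (v : M2).

(** Taken at an arbitrary set [n], so that one notion covers both a valuation [n1] and the full set
    of transitions; [slice (trans M) u] is [out u] by conversion. *)
Definition slice (S : choiceType) (n : {fset S * A * S}) (u : S) : {fset A * S} :=
  [fset (act e, tgt e) | e in n & src e == u].

Definition slice2 (n2 : {fset M1 * (M2 * A * M2)}) u v : {fset A * M2} :=
  [fset (act f.2, tgt f.2) | f in n2 & (f.1 == u) && (src f.2 == v)].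

Lemma in_slice (S : choiceType) (n : {fset S * A * S}) (a : A) (u u' : S) :
  ((a, u') \in slice n u) = ((u, a, u') \in n).
Proof.
apply/imfsetP/idP => [[[[w b] w'] /=] | nu].
  by rewrite !inE /= /src => /andP[nw /eqP <-] [-> ->].
by exists (u, a, u') => //=; rewrite !inE /= nu /src eqxx.
Qed.

Lemma in_slice2 (n2 : {fset M1 * (M2 * A * M2)}) u v a v' :
  ((a, v') \in slice2 n2 u v) = ((u, (v, a, v')) \in n2).
Proof.
apply/imfsetP/idP => [[[w [[x b] x']] /=] | nu].
  by rewrite !inE /= /src /= => /and3P[nw /eqP <- /eqP <-] [-> ->].
by exists (u, (v, a, v')) => //=; rewrite !inE /= nu /src !eqxx.
Qed.

Lemma in_Tran (M : bmts A) (u : M) E :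
  (E \in Tran u) = (E `<=` slice (trans M) u) && sat (mem E) (oblig u).
Proof. by rewrite !inE /= fpowersetE. Qed.

(** The inner clause of [is_refinement], isolated so that it can be compared with [phi]. *)
Definition matching (nR : {set M1 * M2})
    (M : {fset A * M1}) (N : {fset A * M2}) : Prop :=
  (forall a s', (a, s') \in M ->
     exists2 t', (a, t') \in N & (s', t') \in nR) /\
  (forall a t', (a, t') \in N ->
     exists2 s', (a, s') \in M & (s', t') \in nR).

Lemma slice_sub (n1 : {fset M1 * A * M1}) u :
  n1 `<=` XT1 M1 -> slice n1 u `<=` slice (trans M1) u.
Proof. by move=> /fsubsetP n1T; apply/fsubsetP=> -[a u']; rewrite !in_slice; apply: n1T. Qed.

Lemma in_XT2 u v a v' :
  ((u, (v, a, v')) \in XT2 M1 M2) = ((v, a, v') \in trans M2).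
Proof. by rewrite /XT2 in_fsetM /= !inE. Qed.

Lemma slice2_sub (n2 : {fset M1 * (M2 * A * M2)}) u v :
  n2 `<=` XT2 M1 M2 -> slice2 n2 u v `<=` slice (trans M2) v.
Proof.
move=> /fsubsetP n2T; apply/fsubsetP=> -[a v']; rewrite in_slice in_slice2.
by move=> /n2T; rewrite in_XT2.
Qed.

Lemma in_union_val (nR : {set M1 * M2}) n1 n2 :
  (forall p, (AR p \in union_val nR n1 n2) = (p \in nR)) *
  (forall e, (AT1 M2 e \in union_val nR n1 n2) = (e \in n1)) *
  (forall f, (AT2 f \in union_val nR n1 n2) = (f \in n2)).
Proof. by []. Qed.

(** Pulling the valuation back along the renaming of atoms leaves exactly the slice at [u]. *)
Lemma sat_pi1 (nR : {set M1 * M2}) n1 (n2 : {fset M1 * (M2 * A * M2)}) u p :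
  sat (union_val nR n1 n2) (pi1 M2 u p) = sat (mem (slice n1 u)) p.
Proof. by rewrite sat_map; apply: eq_sat => -[a u']; rewrite [RHS]in_slice. Qed.

Lemma sat_pi2 (nR : {set M1 * M2}) n1 n2 u v p :
  sat (union_val nR n1 n2) (pi2 u v p) = sat (mem (slice2 n2 u v)) p.
Proof. by rewrite sat_map; apply: eq_sat => -[a v']; rewrite [RHS]in_slice2. Qed.

(** The conjunctions and disjunctions of [phi] range over [XT1] and [XT2] only; the two inclusions
    ensure that every true transition atom is among their indices. *)
Lemma sat_phi (nR : {set M1 * M2}) n1 n2 u v :
  n1 `<=` XT1 M1 -> n2 `<=` XT2 M1 M2 ->
  sat (union_val nR n1 n2) (phi u v) <->
  matching nR (slice n1 u) (slice2 n2 u v).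
Proof.
move=> /fsubsetP n1T /fsubsetP n2T; rewrite /phi /= !sat_bigAnd.
split=> [/andP[/allP H1 /allP H2] | [H1 H2]].
  split=> a x'.
    rewrite in_slice => n1u; have /= := H1 _ (n1T _ n1u).
    rewrite /src /act eqxx /= sat_bigOr in_union_val n1u /=.
    case/hasP=> -[w [[z b] v']] _ /= /and3P[/and3P[/eqP-> /eqP-> /eqP->] n2f Rf].
    by exists v'; rewrite ?in_slice2.
  rewrite in_slice2 => n2f; have /= := H2 _ (n2T _ n2f).
  rewrite /src /act !eqxx /= sat_bigOr in_union_val n2f /=.
  case/hasP=> -[[w b] u'] _ /= /and3P[/andP[/eqP-> /eqP->] n1e Re].
  by exists u'; rewrite ?in_slice.
apply/andP; split; apply/allP.
  move=> [[w a] u'] _ /=; apply/implyP=> /eqP; rewrite /src /= => ->.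
  rewrite -implybE; apply/implyP=> n1e; rewrite sat_bigOr.
  have [|v' n2f Rf] := H1 a u'; first by rewrite in_slice.
  rewrite in_slice2 in n2f.
  apply/hasP; exists (u, (v, a, v')); first exact: n2T.
  by rewrite /= /src !eqxx /=; apply/andP.
move=> [w [[z a] v']] _ /=; apply/implyP=> /andP[/eqP-> /eqP]; rewrite /src /= => ->.
rewrite -implybE; apply/implyP=> n2f; rewrite sat_bigOr.
have [|u' n1e Re] := H2 a v'; first by rewrite in_slice2.
rewrite in_slice in n1e.
apply/hasP; exists (u, a, u'); first exact: n1T.
by rewrite /= /src !eqxx /=; apply/andP.
Qed.

(** Slices consist of outgoing transitions, so membership in [Tran] reduces to satisfying the
    obligation. *)
Lemma sat_psi (nR : {set M1 * M2}) n1 n2 u v :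
  n1 `<=` XT1 M1 -> n2 `<=` XT2 M1 M2 ->
  sat (union_val nR n1 n2) (psi u v) <->
  (slice n1 u \in Tran u ->
   slice2 n2 u v \in Tran v /\ matching nR (slice n1 u) (slice2 n2 u v)).
Proof.
move=> n1T n2T; rewrite !in_Tran slice_sub // slice2_sub //=.
rewrite sat_pi1 sat_pi2 -implybE; split=> [/implyP H /H/andP[-> ph] | H].
  by split=> //; apply/sat_phi.
by apply/implyP=> /H[-> ph]; apply/sat_phi.
Qed.

Lemma sat_Psi (nR : {set M1 * M2}) n1 n2 (s : M1) (t : M2) :
  sat (union_val nR n1 n2) (Psi s t) <->
  (s, t) \in nR /\
  (forall u v, (u, v) \in nR -> sat (union_val nR n1 n2) (psi u v)).
Proof.
rewrite /Psi /= sat_bigAnd in_union_val.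
split=> [/andP[-> /allP H] | [-> H]]; [split=> // u v uvR | apply/allP=> -[u v] _ /=].
  by have /= := H (u, v) (mem_index_enum _); rewrite in_union_val uvR.
by rewrite -implybE; apply/implyP/H.
Qed.

End Slices.

Theorem theorem1 (A : choiceType) (M1 M2 : bmts A) (s : M1) (t : M2) :
  refines s t <->
  exists nR : {set M1 * M2},
    forall n1 : {fset M1 * A * M1}, n1 `<=` XT1 M1 ->
    exists2 n2 : {fset M1 * (M2 * A * M2)}, n2 `<=` XT2 M1 M2 &
      sat (union_val nR n1 n2) (Psi s t).
Proof.
split=> [[R stR refR] | [R H]]; exists R.
- move=> n1 n1T.
  (* Finite choice needs an answer at every pair; where the premises fail, the empty set serves as a
     default. *)
  have /fin_all_exists[N NP] (p : M1 * M2) : exists N : {fset A * M2},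
      p \in R -> slice n1 p.1 \in Tran p.1 ->
      N \in Tran p.2 /\ matching R (slice n1 p.1) N.
    case: (boolP ((p \in R) && (slice n1 p.1 \in Tran p.1))) => [|/negP npR].
      case: p => u v /andP[/refR/[apply] [[N NT mN]]].
      by exists N.
    by exists fset0 => pR pT; case: npR; rewrite pR.
  (* The chosen answers are glued into a single valuation. *)
  exists [fset f in XT2 M1 M2 | (act f.2, tgt f.2) \in N (f.1, src f.2)].
    exact: fset_sub.
  set n2 := [fset _ in _ | _].
  have n2T : n2 `<=` XT2 M1 M2 by exact: fset_sub.
  apply/sat_Psi; split=> // u v uvR; apply/sat_psi => // uT.
  have [NT mN] := NP (u, v) uvR uT.
  suff -> : slice2 n2 u v = N (u, v) by [].
  apply/fsetP=> -[a v']; rewrite in_slice2 !inE /src /=.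
  (* Restricting to [XT2] loses nothing here, since [N (u, v)] lies in [Tran v] and so contains only
     outgoing transitions of [v]. *)
  apply/andb_idl => inN; move: NT; rewrite in_Tran => /andP[/fsubsetP NT _].
  by have := NT _ inN; rewrite in_slice.
(* The truth of the atom [(s, t)] depends on [R] alone, so any valuation of [XT1] can be tested. *)
- by have [n2 _ /sat_Psi[]] := H fset0 (fsub0set _).
- move=> u v uvR M MT.
  (* The universally quantified valuation is chosen to encode the challenge [M] at [u] and to be
     empty at all other states. *)
  pose n1 := [fset (u, x.1, x.2) | x in M].
  have sM : slice n1 u = M.
    apply/fsetP=> -[a u']; rewrite in_slice.
    apply/imfsetP/idP => [[[b w] /= xM [-> ->]] // | xM].
    by exists (a, u').
  have n1T : n1 `<=` XT1 M1.
    apply/fsubsetP=> _ /imfsetP[[a u'] /= xM ->].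
    move: MT; rewrite in_Tran => /andP[/fsubsetP/(_ _ xM)].
    by rewrite in_slice.
  have [n2 n2T /sat_Psi[_ /(_ _ _ uvR)]] := H n1 n1T.
  by move=> /sat_psi[] // ; rewrite sM // => NT mN; exists (slice2 n2 u v).
Qed.
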